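(* Assume that there exists $\theta_0>0$ such that the moment generating function $M_W(\theta)=\mathbf{E}[e^{\theta W}]$ exists (is finite) for every $\theta<\theta_0$. Then: (i) There exist $\xi>0$ and $C>0$ such that for every $t>0$, $$\int_0^\infty|\psi^\infty(u)-\psi(u,t)|\,du\le C e^{-\xi t}.$$ (ii) There exists $\xi'>0$ such that for every $u>0$ there exists $C(u)>0$ such that for every $t>0$, $$0\le \psi^\infty(u)-\psi(u,t)\le C(u)e^{-\xi' t}.$$
   Context: Let $c>0$ be a constant. Let $(W_i,X_i)$, $i=1,2,\dots$, be independent and identically distributed random vectors with the law of $(W,X)$, where $W\ge 0$ and $X\ge 0$ ($W_i$ and $X_i$ may be dependent on each other). Standing assumptions: $\mathbf{P}(X>0)>0$, $\mathbf{E}[W]<\infty$, $\mathbf{P}(W>0)>0$, and $(W,X)$ has a joint density $f_{W,X}$. Put $T_0=0$, $T_n=W_1+\dots+W_n$. The cash flow process is $$U_t=c\sum_{n=0}^\infty 1_{[T_n,T_{n+1})}(t)\Big\{(t-T_n)e^{-\sum_{i=1}^nX_i}+\sum_{i=1}^n(T_i-T_{i-1})e^{-\sum_{k=1}^{i-1}X_k}\Big\},\quad t\ge 0,$$ with empty sums equal to $0$. For $u>0$ let $\tau_u$ be the first hitting time of level $u$ by $U$ (with $\tau_u=\infty$ if $u$ is never reached), and put $\psi(u,t)=\mathbf{P}(\tau_u<t)$ and $\psi^\infty(u)=\lim_{t\to\infty}\psi(u,t)=\mathbf{P}(\tau_u<\infty)$. *)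

(* Defs.v *)
From HB Require Import structures.
From mathcomp Require Import all_boot all_order all_algebra finmap.
From mathcomp Require Import all_classical all_reals all_analysis.

Set Implicit Arguments.
Unset Strict Implicit.
Unset Printing Implicit Defensive.

Import Order.TTheory GRing.Theory Num.Theory.
Import numFieldNormedType.Exports.

Local Open Scope classical_set_scope.
Local Open Scope ring_scope.

Section random_vectors.
Context d (T : measurableType d) (R : realType) (P : probability T R).

Definition rvec (W X : {RV P >-> R}) : T -> R * R := fun w => (W w, X w).

Lemma measurable_rvec (W X : {RV P >-> R}) : measurable_fun setT (rvec W X).
Proof. by apply: measurable_fun_pair. Qed.

HB.instance Definition _ (W X : {RV P >-> R}) :=
  isMeasurableFun.Build _ _ _ _ (rvec W X) (measurable_rvec W X).

(* Equality of laws is required on measurable sets only: `distribution` is a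
   function on all sets. *)
Definition same_law d' (T' : measurableType d') (Y Z : {RV P >-> T'}) : Prop :=
  forall A : set T', measurable A -> distribution P Y A = distribution P Z A.

Definition mutually_independent (I : choiceType) d' (T' : measurableType d')
    (Z : I -> {RV P >-> T'}) : Prop :=
  forall (J : {fset I}) (A : I -> set T'),
    (forall i, i \in J -> measurable (A i)) ->
    P (\bigcap_(i in [set` J]) (Z i @^-1` A i)) =
      (\prod_(i <- J) P (Z i @^-1` A i))%E.

Definition iid (I : choiceType) d' (T' : measurableType d')
    (Z : I -> {RV P >-> T'}) (Z0 : {RV P >-> T'}) : Prop :=
  mutually_independent Z /\ forall i, same_law (Z i) Z0.

Definition joint_density (W X : {RV P >-> R}) (f : R * R -> R) : Prop :=
  [/\ measurable_fun setT f,
      forall z, 0 <= f z &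
      forall A : set (R * R), measurable A ->
        distribution P (rvec W X) A =
        (\int[(@lebesgue_measure R \x @lebesgue_measure R)%E]_(z in A)
          (f z)%:E)%E].

End random_vectors.

(* The sequences are indexed from 0: `W i` and `X i` stand for the
   (i+1)-st inter-arrival time and discount exponent. *)
Section cash_flow.
Context d (T : measurableType d) (R : realType) (P : probability T R).
Variables (c : R) (W X : nat -> {RV P >-> R}).

Definition arrival (n : nat) (w : T) : R := \sum_(i < n) W i w.

(* At most one term of the series is nonzero when the W i are nonnegative. *)
Definition cash_flow (t : R) (w : T) : R :=
  c * limn (series (fun n : nat =>
    \1_(`[arrival n w, arrival n.+1 w[) t *
    ((t - arrival n w) * expR (- \sum_(i < n) X i w) +
     \sum_(i < n) (arrival i.+1 w - arrival i w) *
                  expR (- \sum_(k < i) X k w)))).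

Definition hitting_time (u : R) (w : T) : \bar R :=
  ereal_inf [set t%:E | t in [set t : R | 0 <= t /\ cash_flow t w = u]].

Definition psi (u t : R) : R :=
  fine (P [set w | (hitting_time u w < t%:E)%E]).

Definition psi_infty (u : R) : R := lim (psi u t @[t --> +oo]).

End cash_flow.

(* Main.v *)
Require Import Defs.
From HB Require Import structures.
From mathcomp Require Import all_boot all_order all_algebra finmap.
From mathcomp Require Import all_classical all_reals all_analysis.
From mathcomp Require Import measurable_realfun ring lra.

Set Implicit Arguments.
Unset Strict Implicit.
Unset Printing Implicit Defensive.

Import Order.TTheory GRing.Theory Num.Theory.
Import numFieldNormedType.Exports.

Local Open Scope classical_set_scope.
Local Open Scope ring_scope.

(** Rescale the level to [v = u / c] and follow the gap that is left at the
    arrivals, measured in current payment units: [V_0 = v] and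
    [V_(n+1) = (V_n - W_n) * exp (X_n)].  Between two arrivals the cash flow is
    affine, so on every path the level is reached before time [t] exactly when
    [0 <= V_n < W_n] and [T_n + V_n < t] for some [n].  Being hit, but not before
    time [t], therefore forces [0 <= V_n < W_n] and [t <= T_(n+1)] for some [n],
    and it suffices to bound the probability of this event by
    [C * q ^ n * exp (- xi * t) * exp (- beta * v)] with [q < 1]: summing over
    [n] gives a bound on [psi_infty - psi] that is uniform in [u] and integrable
    in [u], hence both assertions at once.

    The bound is the geometric mean of two estimates.

    The late arrival has probability at most
    [exp (- theta * t) * M(theta) ^ (n+1)] by the exponential Markov inequality,
    where [M(theta)] is as close to 1 as desired for small [theta] by convexity
    ([arrival_tail], [mgf_interpolation]).

    The crossing at step [n] has probability at most
    [C * sigma ^ n * exp (- gamma * v)] with [sigma < 1] ([crossing_le],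
    [lyap_geometric]).  The gaps form a Markov chain that is lost once negative,
    and the function [lyap], equal to 1 on a plateau [[0, K]] and exponentially
    decreasing beyond it, is a supersolution for its transition operator.  Beyond
    [K] the multiplication by [exp (X_n)] makes a single step halve [lyap] on
    average ([lyap_drift]).  On the plateau the joint density enters: the fixed point
    [W / (1 - exp (- X))] of the random affine step is not almost surely
    constant, so some [v0] lies strictly between its essential bounds
    ([gap_step_spread]).  The steps expand distances, hence gaps above [v0] move
    up by a fixed amount with probability at least [eta], and gaps below [v0]
    move down in the same way.  After a bounded number of steps every gap in the
    plateau has left it with a probability bounded from below
    ([lyap_exit_down], [lyap_exit_up]).

    Expectations along the chain become iterates of the transition operator
    because the state after [n] steps is independent of the next innovation
    ([state_indep], [expect_state_next]). *)

(** * Processes driven by independent innovations *)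

Lemma measure_rectangle_unique d1 d2 (R : realType)
    (T1 : measurableType d1) (T2 : measurableType d2)
    (m1 m2 : {measure set (T1 * T2) -> \bar R}) :
  (m1 setT < +oo)%E ->
  (forall A B, measurable A -> measurable B -> m1 (A `*` B) = m2 (A `*` B)) ->
  forall D, measurable D -> m1 D = m2 D.
Proof.
move=> m1oo m12 D mD.
pose C : set (set (T1 * T2)) := [set A `*` B | A in measurable & B in measurable].
apply: (measure_unique C (fun=> setT)) => //.
- by rewrite measurable_prod_measurableType.
- move=> _ _ [X1 mX1 [X2 mX2 <-]] [Y1 mY1 [Y2 mY2 <-]].
  rewrite -setXI; exists (X1 `&` Y1); first exact: measurableI.
  by exists (X2 `&` Y2) => //; exact: measurableI.
- by move=> _; exists setT => //; exists setT => //; rewrite setXTT.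
- by rewrite bigcup_const.
- by move=> _ [A mA [B mB <-]]; exact: m12.
Qed.

Section markov.
Context d (T : measurableType d) (R : realType) (P : probability T R).
Context dS (S : measurableType dS) dU (U : measurableType dU).
Variables (F : S * U -> S) (s0 : S) (Z : nat -> {RV P >-> U}).
Hypothesis mF : measurable_fun setT F.

Fixpoint state (n : nat) (w : T) : S :=
  if n is m.+1 then F (state m w, Z m w) else s0.

Lemma measurable_state n : measurable_fun setT (state n).
Proof.
elim: n => [|n IH] /=; first exact: measurable_cst.
apply: (measurableT_comp mF); apply: measurable_fun_pair => //.
Qed.

HB.instance Definition _ n := isMeasurableFun.Build _ _ _ _ (state n) (measurable_state n).

Definition state_next n : T -> S * U := fun w => (state n w, Z n w).

Lemma measurable_state_next n : measurable_fun setT (state_next n).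
Proof. by apply: measurable_fun_pair => //; exact: measurable_state. Qed.

HB.instance Definition _ n :=
  isMeasurableFun.Build _ _ _ _ (state_next n) (measurable_state_next n).

Let cyl (J : {fset nat}) (A : nat -> set U) : set T :=
  \bigcap_(i in [set` J]) (Z i @^-1` A i).

Let measurable_cyl (J : {fset nat}) A : (forall i, i \in J -> measurable (A i)) ->
  measurable (cyl J A).
Proof.
move=> mA; apply: fin_bigcap_measurable => // i Ji.
by apply: measurable_funPTI; apply: mA.
Qed.

Section independence.
Hypothesis indep : mutually_independent Z.

(** Induction on [n].  For the step, fix the later innovations: the law of the
    pair (state, innovation) restricted to the event they define and its law
    scaled by the probability of that event agree on rectangles, hence on the
    event that the next state lies in [B].  Keeping an arbitrary finite set [J] of
    later innovations is what makes the induction go through. *)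
Lemma state_indep n (B : set S) (J : {fset nat}) (A : nat -> set U) :
  measurable B -> (forall i, i \in J -> (n <= i)%N) ->
  (forall i, i \in J -> measurable (A i)) ->
  P (state n @^-1` B `&` cyl J A) = (P (state n @^-1` B) * P (cyl J A))%E.
Proof.
elim: n B J A => [|n IH] B J A mB Jn mA.
  have [Bs|Bs] := pselect (B s0).
    have -> : state 0 @^-1` B = setT by apply/seteqP; split.
    by rewrite setTI probability_setT mul1e.
  have -> : state 0 @^-1` B = set0 by apply/seteqP; split.
  by rewrite set0I measure0 mul0e.
have mE := measurable_cyl mA.
have mnext := measurable_state_next n.
pose m1 : {measure set (S * U) -> \bar R} :=
  pushforward (mrestr P mE) (state_next n).
pose m2 : {measure set (S * U) -> \bar R} :=
  mscale (NngNum (fine_ge0 (measure_ge0 P (cyl J A))))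
         (distribution P (state_next n)).
have m1E D : m1 mnext D = P (state_next n @^-1` D `&` cyl J A) by [].
have m2E D : m2 D = (P (cyl J A) * P (state_next n @^-1` D))%E.
  by rewrite /m2 /= /mscale /= fineK ?fin_num_measure.
have key : forall D, measurable D -> m1 mnext D = m2 D.
  apply: (@measure_rectangle_unique _ _ R S U (m1 mnext) m2).
    by rewrite m1E preimage_setT setTI (le_lt_trans (probability_le1 _ _))// ltry.
  move=> C D mC mD; rewrite m1E m2E.
  have -> : state_next n @^-1` (C `*` D) = (state n @^-1` C) `&` (Z n @^-1` D).
    by apply/seteqP; split.
  (* [A'] also constrains the innovation [n], so that the independence of the
     family applies to [n] together with [J]. *)
  pose A' i := if i == n then D else A i.
  have nJ : n \notin J by apply/negP => /Jn; rewrite ltnn.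
  have A'E i : i \in J -> A' i = A i.
    by move=> iJ; rewrite /A'; case: eqP => // e; move: nJ; rewrite -e iJ.
  have mA'1 i : i \in [fset n]%fset -> measurable (A' i).
    by rewrite inE => /eqP ->; rewrite /A' eqxx.
  have mA'J i : i \in (n |` J)%fset -> measurable (A' i).
    rewrite !inE => /orP[/eqP ->|iJ]; first by rewrite /A' eqxx.
    by rewrite A'E//; exact: mA.
  have c1 : Z n @^-1` D = cyl [fset n]%fset A'.
    rewrite /cyl set_fset1 bigcap_set1 /A' eqxx//.
  have c2 : cyl J A = cyl J A'.
    by apply: eq_bigcapr => i /= iJ; rewrite A'E.
  have c3 : Z n @^-1` D `&` cyl J A = cyl (n |` J)%fset A'.
    rewrite /cyl set_fsetU1 bigcap_setU1 {1}/A' eqxx; congr (_ `&` _).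
    exact: c2.
  have PJ : P (cyl (n |` J)%fset A') = (P (Z n @^-1` D) * P (cyl J A))%E.
    rewrite {1}/cyl indep// big_fsetU1//= {1}/A' eqxx; congr (_ * _)%E.
    by rewrite c2 [in RHS]/cyl indep// => i iJ; apply: mA'J; rewrite !inE iJ orbT.
  rewrite -setIA c3 IH//; last first.
    by move=> i; rewrite !inE => /orP[/eqP ->//|/Jn/ltnW].
  rewrite PJ c1 IH//; last by move=> i; rewrite inE => /eqP ->.
  by rewrite -c1 [RHS]muleC muleA.
have mFB : measurable (F @^-1` B) by rewrite -(setTI (_ @^-1` _)); exact: mF.
by have := key _ mFB; rewrite m1E m2E [RHS]muleC.
Qed.

Variable Z0 : {RV P >-> U}.
Hypothesis same : forall i, same_law (Z i) Z0.

Lemma state_next_law n D : measurable D ->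
  distribution P (state_next n) D =
  (distribution P (state n) \x distribution P Z0)%E D.
Proof.
move=> mD; apply/esym/product_measure_unique => // A B mA mB.
have mB1 : forall i, i \in [fset n]%fset -> measurable B by [].
have := state_indep mA (J := [fset n]%fset) (A := fun=> B) (n := n) _ mB1.
rewrite /cyl set_fset1 bigcap_set1 => H.
transitivity (distribution P (state n) A * distribution P (Z n) B)%E.
  by rewrite /distribution /pushforward /= -H// => i; rewrite inE => /eqP ->.
by congr (_ * _)%E; exact: same.
Qed.

(** The Markov property, in the form of an iterated expectation. *)
Lemma expect_state_next (n : nat) (g : (S * U)%type -> \bar R) :
  measurable_fun [set: (S * U)%type] g -> (forall z, 0 <= g z)%E ->
  (\int[P]_w g (state n w, Z n w) =
   \int[P]_w \int[P]_w' g (state n w, Z0 w'))%E.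
Proof.
move=> mg g0.
transitivity (\int[distribution P (state_next n)]_z g z)%E.
  by rewrite ge0_integral_pushforward// ?preimage_setT.
transitivity (\int[(distribution P (state n) \x distribution P Z0)%E]_z g z)%E.
  by apply: eq_measure_integral => D mD _; exact: state_next_law.
rewrite fubini_tonelli1//.
have mf := measurable_fun_fubini_tonelli_F (m2 := distribution P Z0) g mg g0.
rewrite ge0_integral_pushforward ?preimage_setT//; last first.
  by move=> x _; exact: integral_ge0.
apply: eq_integral => w _ /=; rewrite /fubini_F.
rewrite ge0_integral_pushforward ?preimage_setT//.
by apply/measurableT_comp/measurable_pair1.
Qed.

End independence.
End markov.

(** * The transition operator of the gap *)

Definition ge0_mfun (R : realType) (g : R -> \bar R) : Prop :=
  measurable_fun setT g /\ (forall v, 0 <= g v)%E.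

Section kernel.
Context d (T : measurableType d) (R : realType) (P : probability T R).
Variables (W0 X0 : {RV P >-> R}).

(** When a payment period of length [W] ends, the gap [v] has decreased by [W]; the
    payment rate then drops by the factor [exp (- X)], which multiplies the gap
    measured in payment units by [exp X]. *)
Definition gap_step (z : R * (R * R)) : R := (z.1 - z.2.1) * expR z.2.2.

Lemma measurable_gap_step : measurable_fun setT gap_step.
Proof.
apply: measurable_funM.
  by apply: measurable_funB => //; exact: measurableT_comp measurable_snd.
by apply: measurableT_comp => //; exact: measurableT_comp measurable_snd.
Qed.

(** Negative values of [v - W0 w] stay negative, so a gap that has been passed
    never contributes to a function that vanishes on the negative half-line. *)
Definition gap_op (g : R -> \bar R) (v : R) : \bar R :=
  (\int[P]_w g ((v - W0 w) * expR (X0 w))%R)%E.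

Let mstep v : measurable_fun setT (fun w => (v - W0 w) * expR (X0 w)).
Proof.
apply: measurable_funM; first exact: measurable_funB.
exact: measurableT_comp.
Qed.

Lemma measurable_gap_op g : measurable_fun setT g -> (forall v, 0 <= g v)%E ->
  measurable_fun setT (gap_op g).
Proof.
move=> mg g0.
apply: (measurable_fun_fubini_tonelli_F (m2 := P)
  (fun z : R * T => g ((z.1 - W0 z.2) * expR (X0 z.2)))) => //.
apply: measurableT_comp => //; apply: measurable_funM.
  by apply: measurable_funB => //; exact: measurableT_comp measurable_snd.
by apply: measurableT_comp => //; exact: measurableT_comp measurable_snd.
Qed.

Lemma gap_op_ge0 g : (forall v, 0 <= g v)%E -> forall v, (0 <= gap_op g v)%E.
Proof. by move=> g0 v; exact: integral_ge0. Qed.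

Lemma ge0_mfun_iter_gap_op g n : ge0_mfun g ->
  ge0_mfun (iter n gap_op g).
Proof.
move=> g0; elim: n => [//|n [IH1 IH2]] /=; split.
  exact: measurable_gap_op.
exact: gap_op_ge0.
Qed.

Lemma gap_op_le g1 g2 : ge0_mfun g1 -> ge0_mfun g2 ->
  (forall v, g1 v <= g2 v)%E -> forall v, (gap_op g1 v <= gap_op g2 v)%E.
Proof.
move=> [m1 p1] [m2 p2] g12 v; apply: ge0_le_integral => //.
- exact: measurableT_comp.
- exact: measurableT_comp.
Qed.

Lemma gap_opZ g k : ge0_mfun g -> 0 <= k -> forall v,
  gap_op (fun x => k%:E * g x)%E v = (k%:E * gap_op g v)%E.
Proof.
move=> [mg g0] k0 v; rewrite /gap_op ge0_integralZl//.
exact: measurableT_comp.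
Qed.

Lemma iter_gap_op_le g1 g2 n : ge0_mfun g1 -> ge0_mfun g2 ->
  (forall v, g1 v <= g2 v)%E -> forall v, (iter n gap_op g1 v <= iter n gap_op g2 v)%E.
Proof.
move=> n1 n2 g12; elim: n => [//|n IH] /=; apply: gap_op_le => //.
- exact: ge0_mfun_iter_gap_op n1.
- exact: ge0_mfun_iter_gap_op n2.
Qed.

Lemma iter_gap_opZ g k n : ge0_mfun g -> 0 <= k -> forall v,
  iter n gap_op (fun x => k%:E * g x)%E v = (k%:E * iter n gap_op g v)%E.
Proof.
move=> ng k0; elim: n => [//|n IH] v /=.
rewrite -gap_opZ//; last exact: ge0_mfun_iter_gap_op ng.
by congr (gap_op _ v); apply/funext.
Qed.

Lemma integral_le_drop (f : T -> \bar R) (A : set T) (eta b : R) :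
  measurable_fun setT f -> (forall w, 0 <= f w <= 1)%E ->
  measurable A -> (eta%:E <= P A)%E -> 0 <= b <= 1 ->
  (forall w, A w -> f w <= (1 - b)%:E)%E ->
  (\int[P]_w f w <= (1 - eta * b)%:E)%E.
Proof.
move=> mf f01 mA etaA /andP[b0 b1] fA.
have f0 w : (0 <= f w)%E by case/andP: (f01 w).
have mi : measurable_fun setT (fun w => (b * \1_A w)%:E).
  by apply/measurable_EFinP; apply: measurable_funM.
have i0 w : (0 <= (b * \1_A w)%:E)%E by rewrite lee_fin mulr_ge0.
have : (\int[P]_w (f w + (b * \1_A w)%:E) <= \int[P]_w (cst 1 w))%E.
  apply: ge0_le_integral => //.
  - by move=> w _; rewrite adde_ge0.
  - exact: emeasurable_funD.
  move=> w _ /=; rewrite indicE; case: (boolP (w \in A)) => wA /=.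
    rewrite mulr1 (@le_trans _ _ ((1 - b)%:E + b%:E)%E)//.
      by rewrite leeD2r// fA//; rewrite inE in wA.
    by rewrite -EFinD subrK.
  by rewrite mulr0 adde0; case/andP: (f01 w).
rewrite ge0_integralD// integral_cst// mul1e [X in (_ <= X)%E -> _]probability_setT.
have -> : (\int[P]_x (b * \1_A x)%:E = b%:E * P A)%E.
  under eq_integral do rewrite EFinM.
  rewrite ge0_integralZl//; first by rewrite integral_indic// setIT.
  by apply/measurable_EFinP.
move=> h; rewrite EFinB leeBrDr//; apply: le_trans h.
by rewrite leeD2l// EFinM muleC lee_wpmul2l.
Qed.
End kernel.

(** * Spread of one step of the gap *)

Section comparison_sets.
Context d (T : measurableType d) (R : realType) (f g : T -> R).
Hypotheses (mf : measurable_fun setT f) (mg : measurable_fun setT g).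

Lemma measurable_set_lt : measurable [set w | f w < g w].
Proof.
rewrite -(setTI [set _ | _]) (_ : [set w | _] = (fun w => f w < g w) @^-1` [set true]) //.
exact: (measurable_fun_ltr mf mg).
Qed.

Lemma measurable_set_le : measurable [set w | f w <= g w].
Proof.
rewrite -(setTI [set _ | _]) (_ : [set w | _] = (fun w => f w <= g w) @^-1` [set true]) //.
exact: (measurable_fun_ler mf mg).
Qed.

Lemma measurable_set_eq : measurable [set w | f w = g w].
Proof.
rewrite -(setTI [set _ | _]) (_ : [set w | _] = (fun w => f w == g w) @^-1` [set true]).
  exact: (measurable_fun_eqr mf mg).
by apply/seteqP; split=> w /eqP.
Qed.
End comparison_sets.

Lemma measure_bigcup_gt0 d (T : measurableType d) (R : realType)
    (mu : {measure set T -> \bar R}) (A : set T) (F : nat -> set T) :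
  measurable A -> (forall n, measurable (F n)) -> A `<=` \bigcup_n F n ->
  (0 < mu A)%E -> exists n, (0 < mu (F n))%E.
Proof.
move=> mA mF AF A0; apply/not_existsP => F0.
have := measure_sigma_subadditive mu mF mA AF.
rewrite eseries0 ?leNgt ?A0// => n _ _.
by apply/eqP; rewrite eq_le measure_ge0 andbT leNgt; apply/negP/F0.
Qed.

Section nondegeneracy.
Context d (T : measurableType d) (R : realType) (P : probability T R).
Variables (W0 X0 : {RV P >-> R}).
Hypothesis W0_ge0 : forall w, 0 <= W0 w.
Hypothesis X0_ge0 : forall w, 0 <= X0 w.

Local Notation next v w := ((v - W0 w) * expR (X0 w)).

Let mnext v : measurable_fun setT (fun w => next v w).
Proof.
apply: measurable_funM; first exact: measurable_funB.
exact: measurableT_comp.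
Qed.

Let mlt v a : measurable [set w | a < next v w].
Proof. exact: measurable_set_lt. Qed.

Let mgt v a : measurable [set w | next v w < a].
Proof. exact: measurable_set_lt. Qed.

Let mle v a : measurable [set w | a <= next v w].
Proof. exact: measurable_set_le. Qed.

Let mge v a : measurable [set w | next v w <= a].
Proof. exact: measurable_set_le. Qed.

Let expX w : 1 <= expR (X0 w).
Proof. by rewrite -expR0 ler_expR. Qed.

(** Let [r = W0 / (1 - exp (- X0))] be the fixed point of the random step.  A gap
    [v] moves up with positive probability when [P (r < v) > 0] and down when
    [P (v < r) > 0].  At the infimum [alpha] of the gaps of the first kind moving
    up has probability zero, so moving down has positive probability because no
    gap is left in place; the latter survives slightly above [alpha], where moving
    up is possible too. *)
Lemma gap_step_spread :
  (0 < P [set w | (0 < W0 w)%R])%E -> (0 < P [set w | (0 < X0 w)%R])%E ->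
  (forall v, 0 < v -> P [set w | next v w = v] = 0%E) ->
  exists v0 delta eta : R, [/\ 0 < delta, 0 < eta <= 1,
    (eta%:E <= P [set w | (v0 + delta <= next v0 w)%R])%E &
    (eta%:E <= P [set w | (next v0 w <= v0 - delta)%R])%E].
Proof.
move=> Wpos Xpos nofix.
pose U := [set v | (0 < P [set w | (v < next v w)%R])%E].
have mX : measurable [set w | 0 < X0 w].
  exact: measurable_set_lt.
(* A large gap moves up as soon as [X0 > 0]. *)
have U0 : U !=set0.
  have [|n Pn] := measure_bigcup_gt0 mX (fun n => mlt n%:R n%:R) _ Xpos.
    move=> w /= Xw; have e1 : 1 < expR (X0 w) by rewrite -expR0 ltr_expR.
    have [n hn] : exists n : nat, W0 w * expR (X0 w) / (expR (X0 w) - 1) < n%:R.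
      by exists (Num.trunc (W0 w * expR (X0 w) / (expR (X0 w) - 1))).+1; exact: truncnS_gt.
    exists n => //=; rewrite ltr_pdivrMr ?subr_gt0// in hn; nra.
  by exists n%:R.
have Uge0 v : U v -> 0 <= v.
  rewrite /U /= => Pv; rewrite leNgt; apply/negP => v0; move: Pv.
  rewrite (_ : [set w | _] = set0) ?measure0 ?ltxx// -subset0 => w /=.
  by have := W0_ge0 w; have := expX w; nra.
have iU : has_inf U by split => //; exists 0 => v /Uge0.
pose alpha := inf U.
have alpha0 : 0 <= alpha by apply: lb_le_inf => // v /Uge0.
have Ualpha : P [set w | (alpha < next alpha w)%R] = 0%E.
  apply/eqP; rewrite eq_le measure_ge0 andbT leNgt; apply/negP => Ua.
  pose a n := alpha - n.+1%:R^-1.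
  have [|n Pn] := measure_bigcup_gt0 (mlt alpha alpha)
      (fun n => mlt (a n) (a n)) _ Ua.
    move=> w /= aw.
    have e0 := expR_gt0 (X0 w).
    have : 0 < (next alpha w - alpha) / expR (X0 w).
      by rewrite divr_gt0// subr_gt0.
    move=> /ltr_add_invr[k]; rewrite add0r ltr_pdivlMr// => hk.
    exists k => //=; rewrite /a.
    have : 0 < k.+1%:R^-1 :> R by rewrite invr_gt0.
    by move: hk; set e := _^-1; set E := expR _; nra.
  have : alpha <= a n by apply: ge_inf => //; case: iU.
  by rewrite /a lerDl oppr_ge0 leNgt invr_gt0 ltr0Sn.
have Dalpha : (0 < P [set w | (next alpha w < alpha)%R])%E.
  have [a0|a0] := ltP 0 alpha; last first.
    have -> : alpha = 0 by apply/eqP; rewrite eq_le a0.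
    rewrite (_ : [set w | _] = [set w | 0 < W0 w])//.
    apply/seteqP; split=> w /=; rewrite sub0r.
      by rewrite pmulr_llt0 ?expR_gt0// oppr_lt0.
    by rewrite pmulr_llt0 ?expR_gt0// oppr_lt0.
  rewrite lt0e measure_ge0 andbT; apply/eqP => D0.
  have meq : measurable [set w | next alpha w = alpha].
    exact: measurable_set_eq.
  have : P setT = 0%E.
    rewrite (_ : setT = [set w | next alpha w < alpha] `|` ([set w | next alpha w = alpha]
       `|` [set w | alpha < next alpha w])).
      rewrite null_set_setU//; first exact: measurableU.
      by apply: null_set_setU => //; exact: nofix.
    apply/esym/seteqP; split=> // w _ /=.
    by case: (ltgtP (next alpha w) alpha); [left|right;right|right;left].
  by rewrite probability_setT => /eqP; rewrite onee_eq0.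
have [v0 [Uv0 Dv0]] : exists v0, U v0 /\ (0 < P [set w | (next v0 w < v0)%R])%E.
  pose a n := alpha + n.+1%:R^-1.
  have [|n Pn] := measure_bigcup_gt0 (mgt alpha alpha)
      (fun n => mgt (a n) (a n)) _ Dalpha.
    move=> w /= aw.
    have e0 := expR_gt0 (X0 w).
    have : 0 < (alpha - next alpha w) / expR (X0 w).
      by rewrite divr_gt0// subr_gt0.
    move=> /ltr_add_invr[k]; rewrite add0r ltr_pdivlMr// => hk.
    exists k => //=; rewrite /a.
    have : 0 < k.+1%:R^-1 :> R by rewrite invr_gt0.
    by move: hk; set e := _^-1; set E := expR _; nra.
  exists (a n); split=> //.
  have [|v1 Uv1 v1a] := @inf_adherent _ U n.+1%:R^-1 _ iU; first by rewrite invr_gt0.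
  rewrite /U/=; apply: lt_le_trans Uv1 _; apply: le_measure; rewrite ?inE//.
  move=> w /=; rewrite -/alpha -/(a n) in v1a => h.
  by have := expX w; nra.
have mup n : measurable [set w | v0 + n.+1%:R^-1 <= next v0 w] by [].
have [|n1 Pn1] := measure_bigcup_gt0 (mlt v0 v0) mup _ Uv0.
  move=> w /= /ltr_add_invr[k hk]; exists k => //=; exact: ltW.
have mdn n : measurable [set w | next v0 w <= v0 - n.+1%:R^-1] by [].
have [|n2 Pn2] := measure_bigcup_gt0 (mgt v0 v0) mdn _ Dv0.
  move=> w /= /ltr_add_invr[k hk]; exists k => //=.
  by rewrite lerBrDr ltW.
exists v0, (Num.min n1.+1%:R^-1 n2.+1%:R^-1).
pose p1 := fine (P [set w | v0 + n1.+1%:R^-1 <= next v0 w]).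
pose p2 := fine (P [set w | next v0 w <= v0 - n2.+1%:R^-1]).
have p1E : P [set w | v0 + n1.+1%:R^-1 <= next v0 w] = p1%:E.
  by rewrite /p1 fineK// fin_num_measure.
have p2E : P [set w | next v0 w <= v0 - n2.+1%:R^-1] = p2%:E.
  by rewrite /p2 fineK// fin_num_measure.
exists (Num.min p1 p2); split.
- by rewrite lt_min !invr_gt0 !ltr0Sn.
- rewrite lt_min -!lte_fin -p1E -p2E Pn1 Pn2/= ge_min -lee_fin -p1E.
  by rewrite probability_le1.
- apply: (@le_trans _ _ p1%:E); first by rewrite lee_fin ge_min lexx.
  rewrite -p1E; apply: le_measure; rewrite ?inE// => w /=; apply: le_trans.
  by rewrite lerD2l ge_min lexx.
- apply: (@le_trans _ _ p2%:E); first by rewrite lee_fin ge_min lexx orbT.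
  rewrite -p2E; apply: le_measure; rewrite ?inE// => w /= h; apply: le_trans h _.
  by rewrite lerB// ge_min lexx orbT.
Qed.
End nondegeneracy.

(** * The Lyapunov function *)

Section lyapunov.
Context (R : realType).
Implicit Types gamma K v : R.

(** Cutting the exponential off at 1 makes the function bounded by its value on the
    plateau [[0, K]], where no one-step contraction is available. *)
Definition lyap gamma K v : R :=
  if 0 <= v then Num.min 1 (expR (- (gamma * (v - K)))) else 0.

Lemma lyap_ge0 gamma K v : 0 <= lyap gamma K v.
Proof. by rewrite /lyap; case: ifP => // _; rewrite le_min ler01 expR_ge0. Qed.

Lemma lyap_le1 gamma K v : lyap gamma K v <= 1.
Proof. by rewrite /lyap; case: ifP => // _; rewrite ge_min lexx. Qed.

Lemma lyap_le_exp gamma K v : lyap gamma K v <= expR (- (gamma * (v - K))).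
Proof.
by rewrite /lyap; case: ifP => _; rewrite ?expR_ge0// ge_min lexx orbT.
Qed.

Lemma lyap_lt0 gamma K v : v < 0 -> lyap gamma K v = 0.
Proof. by rewrite /lyap leNgt => ->. Qed.

Lemma lyap_plateau gamma K v : 0 <= gamma -> 0 <= v <= K -> lyap gamma K v = 1.
Proof.
move=> g0 /andP[v0 vK]; rewrite /lyap v0 min_l// -expR0 ler_expR.
by rewrite oppr_ge0 mulr_ge0_le0// subr_le0.
Qed.

Lemma lyap_tail gamma K v : 0 <= gamma -> 0 <= K -> K <= v ->
  lyap gamma K v = expR (- (gamma * (v - K))).
Proof.
move=> g0 K0 Kv; rewrite /lyap (le_trans K0 Kv) min_r// -expR0 ler_expR.
by rewrite oppr_le0 mulr_ge0// subr_ge0.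
Qed.

Lemma measurable_lyap gamma K : measurable_fun setT (lyap gamma K).
Proof.
apply: measurable_fun_ifT => //; first exact: measurable_fun_ler.
apply: measurable_minr => //; apply: measurableT_comp => //.
apply: measurable_funN; apply: measurable_funM => //.
exact: measurable_funB.
Qed.
End lyapunov.

Section contraction.
Context d (T : measurableType d) (R : realType) (P : probability T R).
Variables (W0 X0 : {RV P >-> R}).
Hypothesis W0_ge0 : forall w, 0 <= W0 w.
Hypothesis X0_ge0 : forall w, 0 <= X0 w.

Let expX w : 1 <= expR (X0 w).
Proof. by rewrite -expR0 ler_expR. Qed.

(** For [v >= K] the ratio of [gap_op lyap v] to [lyap v] is at most the
    expectation of [exp (gamma * W0)] damped by
    [exp (- gamma * (K - W0)^+ * (exp X0 - 1))].  The damping factor tends to 0 as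
    [K] grows wherever [X0 > 0], so dominated convergence provides [K]. *)
Lemma lyap_drift gamma : 0 < gamma ->
  (\int[P]_w (expR (gamma * W0 w))%:E < +oo)%E ->
  P [set w | X0 w = 0] = 0%E ->
  exists2 K : R, 0 <= K & forall v, K <= v ->
    (gap_op W0 X0 (EFin \o lyap gamma K) v <= (2^-1 * lyap gamma K v)%:E)%E.
Proof.
move=> g0 Mfin X00.
pose damp (k : R) w := expR (- (gamma * Num.max (k - W0 w) 0 * (expR (X0 w) - 1))).
pose f (k : nat) w := (expR (gamma * W0 w) * damp k%:R w)%:E.
have mW : measurable_fun setT (fun w => (expR (gamma * W0 w))%:E).
  by apply/measurable_EFinP; apply: measurableT_comp => //; exact: measurable_funM.
have mdamp k : measurable_fun setT (damp k).
  apply: measurableT_comp => //; apply: measurable_funN.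
  apply: measurable_funM; last first.
    by apply: measurable_funB => //; exact: measurableT_comp.
  apply: measurable_funM => //; apply: measurable_maxr => //.
  exact: measurable_funB.
have mf k : measurable_fun setT (f k).
  apply/measurable_EFinP; apply: measurable_funM => //.
  exact/measurable_EFinP.
have damp01 k w : 0 <= damp k w <= 1.
  have m0 : 0 <= Num.max (k - W0 w) 0 by rewrite le_max lexx orbT.
  rewrite expR_ge0 -expR0 ler_expR oppr_le0 mulr_ge0 ?subr_ge0//.
  by rewrite mulr_ge0// ltW.
have cvf : {ae P, forall w, setT w -> f ^~ w @ \oo --> (cst 0%E : T -> \bar R) w}.
  exists [set w | X0 w = 0]; split => //.
    by apply: measurable_set_eq.
  move=> w /=; apply: contra_notP => Xw _.
  have {}Xw : 0 < X0 w by rewrite lt_neqAle X0_ge0 andbT eq_sym; exact/eqP.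
  pose a := gamma * (expR (X0 w) - 1).
  have a0 : 0 < a by rewrite mulr_gt0// subr_gt0 -expR0 ltr_expR.
  apply: cvg_EFin; first exact: nearW.
  (* Dropping the positive part leaves a geometric sequence in [k]. *)
  apply: (@squeeze_cvgr _ _ _ _ (cst 0)
    (geometric (expR (gamma * W0 w) * expR (a * W0 w)) (expR (- a)))).
  - apply: nearW => k /=; have /andP[d0 _] := damp01 k%:R w.
    rewrite mulr_ge0 ?expR_ge0//=.
    rewrite -mulrA ler_wpM2l ?expR_ge0// -expRM_natl -expRD ler_expR.
    rewrite -mulrA (mulrC (Num.max _ _)) mulrA -/a.
    have : k%:R - W0 w <= Num.max (k%:R - W0 w) 0 by rewrite le_max lexx.
    by set m := Num.max _ _; rewrite /= mulrN; nra.
  - exact: cvg_cst.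
  - by apply: cvg_geometric; rewrite ger0_norm ?expR_ge0// -expR0 ltr_expR oppr_lt0.
have iW : P.-integrable setT (fun w => (expR (gamma * W0 w))%:E).
  apply/integrableP; split => //.
  by under eq_integral do rewrite gee0_abs ?lee_fin ?expR_ge0//.
have fW : {ae P, forall w n, setT w -> (`|f n w| <= (expR (gamma * W0 w))%:E)%E}.
  apply: aeW => w n _; have /andP[d0 d1] := damp01 n%:R w.
  by rewrite gee0_abs lee_fin ?mulr_ge0 ?expR_ge0// ler_piMr ?expR_ge0.
have [_ _] := dominated_convergence measurableT mf (measurable_cst _) cvf iW fW.
rewrite integral0_eq// => /fine_cvgP[finf].
move=> /cvgrPdist_le /(_ 2^-1); rewrite invr_gt0 ltr0n => /(_ isT) hf.
have [k /= [kfin kle]] := filter_ex (filterI finf hf).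
exists k%:R => // v kv.
have k0 : 0 <= k%:R :> R by [].
have -> : lyap gamma k%:R v = expR (- (gamma * (v - k%:R))).
  by rewrite lyap_tail// ltW.
apply: (@le_trans _ _ (\int[P]_w ((expR (- (gamma * (v - k%:R))))%:E * f k w))%E).
  apply: ge0_le_integral => //.
  - by move=> w _; rewrite lee_fin lyap_ge0.
  - apply/measurable_EFinP; apply: measurableT_comp; first exact: measurable_lyap.
    apply: measurable_funM; first exact: measurable_funB.
    exact: measurableT_comp.
  - exact: measurable_funeM.
  move=> w _ /=; rewrite -EFinM lee_fin.
  have [vW|vW] := ltP (v - W0 w) 0.
    rewrite lyap_lt0 ?mulr_ge0 ?expR_ge0//.
    by rewrite pmulr_llt0 ?expR_gt0.
  apply: le_trans (lyap_le_exp _ _ _) _.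
  rewrite -!expRD ler_expR.
  have e1 := expX w.
  have : Num.max (k%:R - W0 w) 0 <= v - W0 w by rewrite ge_max vW lerB.
  set m := Num.max _ _; set E := expR _ => mv.
  have : 0 <= (v - W0 w - m) * (E - 1) by rewrite mulr_ge0// subr_ge0.
  by nra.
rewrite ge0_integralZl//; last by move=> w _; rewrite lee_fin mulr_ge0 ?expR_ge0.
rewrite EFinM muleC lee_wpmul2r ?lee_fin ?expR_ge0//.
rewrite -(fineK kfin) lee_fin.
by move: kle; rewrite sub0r normrN; apply: le_trans; rewrite ler_norm.
Qed.

Section iterates.
Variables (gamma K : R).
Hypotheses (gamma0 : 0 < gamma) (K0 : 0 <= K).
Hypothesis drift : forall v, K <= v ->
  (gap_op W0 X0 (EFin \o lyap gamma K) v <= (2^-1 * lyap gamma K v)%:E)%E.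

Local Notation H := (EFin \o lyap gamma K).
Local Notation Q := (gap_op W0 X0).
Local Notation next v w := ((v - W0 w) * expR (X0 w)).

Let mH : measurable_fun setT H.
Proof. by apply/measurable_EFinP; exact: measurable_lyap. Qed.

Let H0 v : (0 <= H v)%E.
Proof. by rewrite lee_fin lyap_ge0. Qed.

Let nH : ge0_mfun H.
Proof. by split; [exact: mH | exact: H0]. Qed.

Let nQ n : ge0_mfun (iter n Q H).
Proof. exact: ge0_mfun_iter_gap_op. Qed.

Lemma gap_op_lyap_le v : (Q H v <= H v)%E.
Proof.
have [v0|v0] := ltP v 0.
  rewrite /gap_op integral0_eq ?H0// => w _ /=; rewrite lyap_lt0//.
  rewrite pmulr_llt0 ?expR_gt0//; have := W0_ge0 w; lra.
have [vK|vK] := leP K v.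
  apply: le_trans (drift vK) _; rewrite lee_fin.
  by have := lyap_ge0 gamma K v; lra.
have -> : H v = 1%E by rewrite /= lyap_plateau ?v0 ?ltW.
apply: (@le_trans _ _ (Q (cst 1%E) v)).
  by apply: gap_op_le => // x; rewrite /= lee_fin lyap_le1.
by rewrite /gap_op integral_cst// mul1e; exact: probability_le1.
Qed.

Lemma iter_gap_op_lyap_le n v : (iter n Q H v <= H v)%E.
Proof.
elim: n v => [//|n IH] v /=; apply: le_trans (gap_op_lyap_le v).
exact: gap_op_le.
Qed.

Lemma iter_gap_op_lyap_half n v : K <= v ->
  (iter n.+1 Q H v <= (2^-1 * lyap gamma K v)%:E)%E.
Proof.
move=> Kv; apply: le_trans (drift Kv); rewrite /=.
by apply: gap_op_le => //; exact: iter_gap_op_lyap_le.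
Qed.

Let Q01 n v w : (0 <= iter n Q H (next v w) <= 1)%E.
Proof.
rewrite (nQ n).2/=; apply: le_trans (iter_gap_op_lyap_le _ _) _.
by rewrite lee_fin lyap_le1.
Qed.

Let mnext v : measurable_fun setT (fun w => next v w).
Proof.
apply: measurable_funM; first exact: measurable_funB.
exact: measurableT_comp.
Qed.

Variables (v0 delta eta : R).
Hypotheses (delta0 : 0 < delta) (eta01 : 0 < eta <= 1).
Hypothesis up : (eta%:E <= P [set w | (v0 + delta <= next v0 w)%R])%E.
Hypothesis down : (eta%:E <= P [set w | (next v0 w <= v0 - delta)%R])%E.

(** A step expands distances, so below [v0] it moves down by [delta] at least
    whenever it does so at [v0]; [j] such moves make the gap negative, where
    [lyap] vanishes. *)
Lemma lyap_exit_down j v : v <= v0 -> v < j%:R * delta ->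
  (iter j Q H v <= (1 - eta ^+ j)%:E)%E.
Proof.
have /andP[e0 e1] := eta01.
elim: j v => [|j IH] v vv0; first by rewrite mul0r expr0 subrr /= => /lyap_lt0 ->.
move=> vj; rewrite /= exprS.
apply: (integral_le_drop (b := eta ^+ j) _ _ _ down) => //.
- by apply: measurableT_comp => //; exact: (nQ _).1.
- exact: measurable_set_le.
- by rewrite exprn_ge0 ?(ltW e0)//= exprn_ile1 ?(ltW e0).
move=> w /= hw; have hv : next v w <= v - delta.
  have : 0 <= (v0 - v) * (expR (X0 w) - 1) by rewrite mulr_ge0// subr_ge0.
  by nra.
apply: IH; first by have := delta0; lra.
by move: vj; rewrite -natr1; lra.
Qed.

(* From [L] on, [lyap] is at most [exp (- 1)], that is [1 - b]. *)
Let L := K + gamma^-1.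
Let b : R := 1 - expR (- 1).

Let b01 : 0 < b <= 1.
Proof.
by rewrite subr_gt0 gerBl expR_ge0 andbT -[ltRHS]expR0 ltr_expR ltrN10.
Qed.

(** The mirror image above [v0]: upward moves bring the gap to the level [L]. *)
Lemma lyap_exit_up j v : v0 <= v -> L - j%:R * delta <= v ->
  (iter j Q H v <= (1 - eta ^+ j * b)%:E)%E.
Proof.
have /andP[e0 e1] := eta01; have /andP[b0 b1] := b01.
elim: j v => [|j IH] v vv0.
  rewrite mul0r subr0 expr0 mul1r /= => Lv; rewrite lee_fin /b opprB addrC subrK.
  apply: le_trans (lyap_le_exp _ _ _) _; rewrite ler_expR lerN2.
  rewrite -(divff (lt0r_neq0 gamma0)) ler_pM2l//.
  by rewrite lerBrDl.
move=> vj; rewrite /= exprS -mulrA.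
apply: (integral_le_drop (b := eta ^+ j * b) _ _ _ up) => //.
- by apply: measurableT_comp => //; exact: (nQ _).1.
- exact: measurable_set_le.
- rewrite mulr_ge0 ?exprn_ge0 ?(ltW e0) ?(ltW b0)//=.
  by rewrite mulr_ile1 ?exprn_ge0 ?exprn_ile1 ?(ltW e0) ?(ltW b0).
move=> w /= hw; have hv : v + delta <= next v w.
  have : 0 <= (v - v0) * (expR (X0 w) - 1) by rewrite mulr_ge0// subr_ge0.
  by nra.
apply: IH; first by have := delta0; lra.
by move: vj; rewrite -natr1; lra.
Qed.

(** The number [m] of steps is such that, whatever the gap in the plateau, one of
    the two exits can be completed. Beyond the plateau a single step is enough,
    because [lyap] is a supersolution. *)
Lemma lyap_contraction : exists (m : nat) (rho : R), [/\ (0 < m)%N, 0 < rho < 1 &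
  forall v, (iter m Q H v <= rho%:E * H v)%E].
Proof.
have /andP[e0 e1] := eta01; have /andP[b0 b1] := b01.
pose m := (Num.trunc ((`|v0| + `|L|) / delta)).+1.
have hm : `|v0| + `|L| < m%:R * delta.
  by rewrite -ltr_pdivrMr//; exact: truncnS_gt.
have eb : 0 < eta ^+ m * b <= 1.
  rewrite mulr_gt0 ?exprn_gt0//=.
  by rewrite mulr_ile1 ?exprn_ge0 ?exprn_ile1 ?(ltW e0) ?(ltW b0).
have /andP[eb0 eb1] := eb.
have all_le v : (iter m Q H v <= (1 - eta ^+ m * b)%:E)%E.
  have [vv0|vv0] := leP v v0.
    apply: (@le_trans _ _ (1 - eta ^+ m)%:E).
      apply: lyap_exit_down => //; apply: le_lt_trans vv0 _.
      by have := ler_norm v0; have := normr_ge0 L; lra.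
    by rewrite lee_fin lerB// ler_piMr// exprn_ge0// ltW.
  apply: lyap_exit_up; first exact: ltW.
  by have := ler_norm L; have := ler_norm (- v0); rewrite normrN; lra.
exists m, (Num.max 2^-1 (1 - eta ^+ m * b)); split => //.
  by rewrite lt_max invr_gt0 ltr0n/= gt_max; apply/andP; split; lra.
move=> v; have [v0'|v0'] := ltP v 0.
  apply: le_trans (iter_gap_op_lyap_le _ _) _.
  by rewrite /= lyap_lt0// mule0.
have [Kv|Kv] := leP K v.
  apply: le_trans (iter_gap_op_lyap_half _ Kv) _.
  by rewrite -EFinM lee_fin ler_wpM2r ?lyap_ge0// le_max lexx.
have -> : H v = 1%E by rewrite /= lyap_plateau ?v0' ?ltW.
apply: le_trans (all_le v) _.
by rewrite mule1 lee_fin le_max lexx orbT.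
Qed.

Lemma lyap_geometric : exists (sigma C : R), [/\ 0 < sigma < 1, 0 < C &
  forall n v, (iter n Q H v <= (C * sigma ^+ n)%:E * H v)%E].
Proof.
have [m [rho [m0 /andP[rho0 rho1] con]]] := lyap_contraction.
have conj j v : (iter (j * m) Q H v <= (rho ^+ j)%:E * H v)%E.
  elim: j v => [|j IH] v; first by rewrite mul0n expr0 mul1e.
  rewrite mulSn addnC iterD.
  have nR : ge0_mfun (fun v => rho%:E * H v)%E.
    split; first exact: measurable_funeM.
    by move=> x; rewrite mule_ge0// lee_fin ltW.
  apply: le_trans (iter_gap_op_le _ _ _ (nQ m) nR con v) _.
  rewrite (iter_gap_opZ _ _ _ nH (ltW rho0)) exprS EFinM -muleA.
  by apply: lee_wpmul2l; [rewrite lee_fin ltW | exact: IH].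
have [sigma /andP[s0 s1] sE] : exists2 sigma : R, 0 < sigma < 1 & sigma ^+ m = rho.
  exists (expR (ln rho / m%:R)).
    rewrite expR_gt0/= -[ltRHS]expR0 ltr_expR pmulr_llt0 ?invr_gt0 ?ltr0n//.
    by rewrite ln_lt0// rho0.
  have mn0 : m%:R != 0 :> R by rewrite pnatr_eq0 -lt0n.
  by rewrite -expRM_natr mulfVK// lnK// posrE.
exists sigma, rho^-1; split; rewrite ?s0 ?invr_gt0// => n v.
rewrite (divn_eq n m) iterD.
apply: (@le_trans _ _ (iter (n %/ m * m) Q H v)).
  by apply: iter_gap_op_le => //; exact: iter_gap_op_lyap_le.
apply: le_trans (conj _ _) _; apply: lee_wpmul2r; first exact: H0.
rewrite lee_fin exprD mulnC exprM sE mulrCA ler_peMr ?exprn_ge0 ?(ltW rho0)//.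
rewrite -sE ler_pdivlMl ?exprn_gt0// mulr1.
by apply: ler_wiXn2l; [exact: ltW|exact: ltW|exact/ltnW/ltn_pmod].
Qed.

End iterates.
End contraction.

(** * Consequences of the joint density *)

(** A set whose vertical sections have at most one point is Lebesgue-null. *)
Lemma joint_density_null d (T : measurableType d) (R : realType)
    (P : probability T R) (W0 X0 : {RV P >-> R}) (f : R * R -> R)
    (A : set (R * R)) :
  joint_density W0 X0 f -> measurable A ->
  (forall x y1 y2, A (x, y1) -> A (x, y2) -> y1 = y2) ->
  P [set w | A (W0 w, X0 w)] = 0%E.
Proof.
move=> [mf f0 fE] mA A1.
have -> : P [set w | A (W0 w, X0 w)] = distribution P (rvec W0 X0) A by [].
rewrite fE//; apply: null_set_integral => //.
  by apply/measurable_EFinP; exact: measurable_funS mf.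
transitivity (\int[@lebesgue_measure R]_x (@lebesgue_measure R (xsection A x)))%E.
  by [].
apply: integral0_eq => x _.
have [->|/set0P[y Ay]] := eqVneq (xsection A x) set0.
  by rewrite measure0.
have -> : xsection A x = [set y].
  apply/seteqP; split=> [z|z ->//]; move: Ay; rewrite /xsection/= !inE => Ay Az.
  exact: A1 Az Ay.
by rewrite lebesgue_measure_set1.
Qed.

(** * Pathwise description of the hitting time *)

Section pathwise.
Context d (T : measurableType d) (R : realType) (P : probability T R).
Variables (c : R) (W X : nat -> {RV P >-> R}).
Hypothesis c_gt0 : 0 < c.
Hypothesis W_ge0 : forall i w, 0 <= W i w.

Let Z i : {RV P >-> (R * R)%type} := rvec (W i) (X i).
Local Notation Tn := (arrival W).
Let S n w := \sum_(i < n) X i w.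
Let A n w := \sum_(i < n) (Tn i.+1 w - Tn i w) * expR (- \sum_(k < i) X k w).

Lemma arrivalS n w : Tn n.+1 w = Tn n w + W n w.
Proof. by rewrite /arrival big_ord_recr. Qed.

Lemma arrival_homo w : {homo (fun n => Tn n w) : m n / (m <= n)%N >-> m <= n}.
Proof.
by apply: homo_leq => [x//|y x z|n]; [exact: le_trans|rewrite arrivalS lerDl].
Qed.

(** [A n w] is the discounted amount received up to the [n]-th arrival (for
    [c = 1]), so the gap is what remains to be received, in units of the payment
    rate [exp (- S n w)] that is then in force. *)
Lemma gap_stateE v n w :
  state (@gap_step R) v Z n w = (v - A n w) * expR (S n w).
Proof.
elim: n => [|n IH] /=; first by rewrite /A /S !big_ord0 subr0 expR0 mulr1.
rewrite IH /gap_step /= /A /S !big_ord_recr/= -/(A n w) -/(S n w).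
rewrite arrivalS [Tn n w + _]addrC addrK expRD expRN.
by field; rewrite gt_eqF// expR_gt0.
Qed.

Let cf_term (t : R) w (n : nat) : R := \1_(`[Tn n w, Tn n.+1 w[) t *
  ((t - Tn n w) * expR (- S n w) + A n w).

Let cash_flow_def t w : cash_flow c W X t w = c * limn (series (cf_term t w)).
Proof. by []. Qed.

Lemma cash_flow_on n t w : Tn n w <= t < Tn n.+1 w ->
  cash_flow c W X t w = c * ((t - Tn n w) * expR (- S n w) + A n w).
Proof.
move=> /andP[nt tn]; rewrite cash_flow_def; congr (_ * _).
apply: lim_near_cst => //; exists n.+1 => // N /= nN.
rewrite /series/= big_mkord (bigD1 (Ordinal nN))//= big1 ?addr0.
  by rewrite /cf_term indicE mem_set ?mul1r//= in_itv/= nt tn.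
move=> i /eqP iN; rewrite /cf_term indicE memNset ?mul0r//= in_itv/= => /andP[h1 h2].
apply: iN; apply/val_inj => /=; apply/eqP; rewrite eqn_leq; apply/andP; split.
  rewrite leqNgt; apply/negP => /(arrival_homo w) h.
  by have := lt_le_trans tn (le_trans h h1); rewrite ltxx.
rewrite leqNgt; apply/negP => /(arrival_homo w) h.
by have := lt_le_trans h2 (le_trans h nt); rewrite ltxx.
Qed.

Lemma cash_flow_off t w : (forall n, ~ (Tn n w <= t < Tn n.+1 w)) ->
  cash_flow c W X t w = 0.
Proof.
move=> off; rewrite cash_flow_def (_ : limn _ = 0) ?mulr0//.
apply: lim_near_cst => //; exists 0%N => // N _; rewrite /series/= big1// => i _.
by rewrite /cf_term indicE memNset ?mul0r//= in_itv/=; exact: off.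
Qed.

(** [V_n] is also the time from the [n]-th arrival to the instant at which the
    level would be reached if payments continued at the current rate. *)
Definition hit_before (v t : R) (n : nat) : set T :=
  [set w | [/\ 0 <= state (@gap_step R) v Z n w,
               state (@gap_step R) v Z n w < W n w &
               Tn n w + state (@gap_step R) v Z n w < t]].

(** In the [n]-th payment period the cash flow takes the value [u] at the single
    time [T_n + V_n], provided that this time belongs to the period.  The identity
    holds on every path: where the arrivals accumulate, the cash flow vanishes
    from the accumulation time on and does not meet a positive level. *)
Lemma hitting_time_ltE u t : 0 < u ->
  [set w | (hitting_time c W X u w < t%:E)%E] = \bigcup_n hit_before (u / c) t n.
Proof.
move=> u0; have c0 : c != 0 by rewrite gt_eqF.
apply/seteqP; split => [w /= /ereal_inf_lt[_ [s /= [s0 su] <-]]|w [n _ [V0 VW TV]]].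
  rewrite lte_fin => st.
  have [n nE] : exists n, Tn n w <= s < Tn n.+1 w.
    apply: contrapT => /forallNP off; move: u0.
    by rewrite -su (cash_flow_off off) ltxx.
  have VE : state (@gap_step R) (u / c) Z n w = s - Tn n w.
    rewrite gap_stateE -su (cash_flow_on nE) expRN.
    by field; rewrite c0 gt_eqF// expR_gt0.
  have /andP[h1 h2] := nE; rewrite arrivalS in h2.
  by exists n => //; rewrite /hit_before /= VE; split; lra.
set V := state _ _ _ _ _ in V0 VW TV.
apply: (@le_lt_trans _ _ (Tn n w + V)%:E); last by rewrite lte_fin.
apply: ereal_inf_lbound => /=; exists (Tn n w + V) => //=; split.
  by rewrite addr_ge0// /arrival sumr_ge0.
have -> : cash_flow c W X (Tn n w + V) w =
    c * ((Tn n w + V - Tn n w) * expR (- S n w) + A n w).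
  by apply: cash_flow_on; rewrite arrivalS; lra.
rewrite /V gap_stateE expRN.
by field; rewrite c0 gt_eqF// expR_gt0.
Qed.

End pathwise.

(** * Probabilities of crossings and of late arrivals *)

(** Convexity on the segment from 0 to [x]: the tangent of [exp] at [l * x] lies
    below [exp] at both ends. *)
Lemma expR_secant (R : realType) (l x : R) : 0 <= l <= 1 ->
  expR (l * x) <= 1 - l + l * expR x.
Proof.
move=> /andP[l0 l1].
have eE : expR x = expR (l * x) * expR ((1 - l) * x).
  by rewrite -expRD; congr expR; ring.
have e1 : 1 = expR (l * x) * expR (- (l * x)) by rewrite -expRD subrr expR0.
have h1 := expR_ge1Dx ((1 - l) * x); have h2 := expR_ge1Dx (- (l * x)).
have e0 := expR_gt0 (l * x).
have k1 : l * (expR (l * x) * (1 + (1 - l) * x)) <= l * expR x.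
  by rewrite eE ler_wpM2l// ler_wpM2l// ltW.
have k2 : (1 - l) * (expR (l * x) * (1 - l * x)) <= 1 - l.
  by rewrite -[leRHS]mulr1 [X in _ <= _ * X]e1 ler_wpM2l ?subr_ge0// ler_wpM2l// ltW.
apply: le_trans (lerD k2 k1); rewrite le_eqVlt; apply/orP; left; apply/eqP; ring.
Qed.

(** The integral of a nonnegative function is a supremum over the simple functions
    below it, hence monotone for arbitrary integrands, measurable or not. *)
Lemma le_integral_pointwise d (T : measurableType d) (R : realType)
    (mu : {measure set T -> \bar R}) (D : set T) (f g : T -> \bar R) :
  (forall x, D x -> 0 <= f x)%E -> (forall x, D x -> f x <= g x)%E ->
  (\int[mu]_(x in D) f x <= \int[mu]_(x in D) g x)%E.
Proof.
move=> f0 fg.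
rewrite !ge0_integralE//; last by move=> x Dx; exact: le_trans (f0 x Dx) (fg x Dx).
apply: le_ereal_sup => _ [h hf <-]; exists h => // x.
by apply: le_trans (hf x) _; exact: lee_restrict.
Qed.

Lemma integral_exp_le (R : realType) (beta k : R) : 0 < beta -> 0 <= k ->
  (\int[@lebesgue_measure R]_(u in `]0%R, +oo[) (k * expR (- beta * u))%:E
   <= (k / beta)%:E)%E.
Proof.
move=> b0 k0.
rewrite integral_mkcond.
have kb0 : 0 <= k / beta by rewrite divr_ge0// ltW.
apply: (@le_trans _ _ (\int[@lebesgue_measure R]_u
    ((k / beta)%:E * (exponential_pdf beta u)%:E))%E).
  apply: le_integral_pointwise => x _.
    by apply: erestrict_ge0 => y _; rewrite lee_fin mulr_ge0 ?expR_ge0.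
  rewrite patchE; case: ifPn => [|_].
    rewrite inE/= in_itv/= andbT => x0.
    rewrite (exponential_pdfE _ (ltW x0)) -EFinM mulrA divfK//.
    by rewrite gt_eqF.
  by rewrite mule_ge0 ?lee_fin// exponential_pdf_ge0// ltW.
rewrite ge0_integralZl//.
- by rewrite integral_exponential_pdf// mule1.
- by apply/measurable_EFinP; exact: measurable_exponential_pdf.
- by move=> x _; rewrite lee_fin exponential_pdf_ge0// ltW.
Qed.

Lemma measure_integral_indic d (T : measurableType d) (R : realType)
    (mu : {measure set T -> \bar R}) (A : set T) : measurable A ->
  mu A = (\int[mu]_w (\1_A w)%:E)%E.
Proof. by move=> mA; rewrite integral_indic// setIT. Qed.

Section estimates.
Context d (T : measurableType d) (R : realType) (P : probability T R).
Variables (W0 X0 : {RV P >-> R}) (W X : nat -> {RV P >-> R}).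
Hypothesis W0_ge0 : forall w, 0 <= W0 w.
Hypothesis W_ge0 : forall i w, 0 <= W i w.
Let Z i : {RV P >-> (R * R)%type} := rvec (W i) (X i).
Hypothesis WX_iid : iid Z (rvec W0 X0).

Local Notation V v := (state (@gap_step R) v Z).

Let mV v n : measurable_fun setT (V v n).
Proof. by apply: measurable_state; exact: measurable_gap_step. Qed.

(** Peeling off the last step turns [g] into [gap_op g], so the induction is over
    all [g]. *)
Lemma expect_gap_state v n (g : R -> \bar R) : ge0_mfun g ->
  (\int[P]_w g (V v n w) = iter n (gap_op W0 X0) g v)%E.
Proof.
elim: n g => [|n IH] g [mg g0].
  rewrite /= integral_cst// [X in (_ * X)%E](_ : _ = 1%E) ?mule1//.
  exact: probability_setT.
rewrite iterSr -IH; last by split; [exact: measurable_gap_op|exact: gap_op_ge0].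
have [ind same] := WX_iid.
have mgs : measurable_fun setT (g \o @gap_step R).
  by apply: measurableT_comp => //; exact: measurable_gap_step.
have /(_ (fun z => g0 _)) := expect_state_next v (@measurable_gap_step R) ind same n mgs.
exact.
Qed.

Variables (gamma M : R).
Hypotheses (gamma0 : 0 < gamma).
Hypothesis ME : (\int[P]_w (expR (gamma * W0 w))%:E = M%:E)%E.

Let mexp (a : R) (Y : T -> R) : measurable_fun setT Y ->
  measurable_fun setT (fun w => (expR (a * Y w))%:E).
Proof.
move=> mY; apply/measurable_EFinP; apply: measurableT_comp => //.
exact: measurable_funM.
Qed.

Lemma mgf_ge1 : 1 <= M.
Proof.
rewrite -lee_fin -ME -[leLHS](@probability_setT _ _ _ P) -[leLHS]mul1e -integral_cst//.
apply: le_integral_pointwise => w _ //=.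
by rewrite lee_fin -expR0 ler_expR mulr_ge0// ltW.
Qed.

(** Given the gap [s >= 0], the crossing [s < W_n] has probability at most
    [M * exp (- gamma * s)] by the exponential Markov inequality, and
    [exp (- gamma * s) <= lyap gamma K s]. *)
Lemma crossing_le v K n : 0 <= K ->
  (P [set w | (0 <= V v n w < W n w)%R] <=
   M%:E * iter n (gap_op W0 X0) (EFin \o lyap gamma K) v)%E.
Proof.
move=> K0; have [ind same] := WX_iid.
pose g (z : R * (R * R)) : \bar R := (\1_[set z | 0 <= z.1 < z.2.1] z)%:E.
have mB : measurable [set z : R * (R * R) | 0 <= z.1 < z.2.1].
  rewrite (_ : [set _ | _] = [set z | 0 <= z.1] `&` [set z | z.1 < z.2.1]).
    apply: measurableI; first exact: measurable_set_le.
    by apply: measurable_set_lt => //; exact: measurableT_comp measurable_snd.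
  by apply/seteqP; split=> z /= => [/andP[]//|[-> ->]].
have mg : measurable_fun setT g by apply/measurable_EFinP.
have mE : measurable [set w | 0 <= V v n w < W n w].
  have mz : measurable_fun setT (fun w => (V v n w, Z n w)).
    by apply: measurable_fun_pair.
  by have := mz measurableT _ mB; rewrite setTI.
have -> : P [set w | (0 <= V v n w < W n w)%R] = (\int[P]_w g (V v n w, Z n w))%E.
  rewrite (measure_integral_indic P mE).
  by apply: eq_integral => w _; rewrite /g !indicE.
rewrite (expect_state_next v (@measurable_gap_step R) ind same n mg)//; last first.
  by move=> z; rewrite lee_fin.
have mH : ge0_mfun (EFin \o lyap gamma K).
  split; first by apply/measurable_EFinP; exact: measurable_lyap.
  by move=> x; rewrite lee_fin lyap_ge0.
have M0 : 0 <= M by apply: le_trans mgf_ge1.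
have mHV : measurable_fun setT (fun w => (EFin \o lyap gamma K) (V v n w)).
  exact: measurableT_comp mH.1 (mV v n).
rewrite -expect_gap_state//.
rewrite -(ge0_integralZl P measurableT mHV) ?lee_fin//; last first.
  by move=> w _; exact: mH.2.
apply: le_integral_pointwise => w _.
  by apply: integral_ge0 => w' _; rewrite lee_fin.
rewrite -[in leRHS]ME.
set s := V v n w.
have [s0|s0] := ltP s 0.
  rewrite integral0_eq; first by rewrite /= lyap_lt0// mule0.
  by move=> w' _; rewrite /g indicE memNset//= leNgt s0.
have mW : measurable_fun setT (fun w => (expR (gamma * W0 w))%:E) by exact: mexp.
rewrite muleC -(ge0_integralZl P measurableT mW); last 2 first.
- by move=> w' _; rewrite lee_fin expR_ge0.
- exact: mH.2.
apply: le_integral_pointwise => w' _; rewrite /g.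
  by rewrite lee_fin.
rewrite indicE -EFinM lee_fin; case: (boolP (_ \in _)) => [|_]; last first.
  by rewrite mulr_ge0 ?lyap_ge0 ?expR_ge0.
rewrite inE /= => /andP[_ sW].
rewrite /lyap s0 minr_pMl ?expR_ge0// le_min mul1r -expRD -expR0 !ler_expR.
by have := gamma0 => g0; apply/andP; split; nra.
Qed.

Lemma measurable_arrival n : measurable_fun setT (arrival W n).
Proof. by apply: measurable_sum. Qed.

Lemma expect_arrival_exp theta Mt n : 
  (\int[P]_w (expR (theta * W0 w))%:E = Mt%:E)%E ->
  (\int[P]_w (expR (theta * arrival W n w))%:E = (Mt ^+ n)%:E)%E.
Proof.
move=> MtE; have [ind same] := WX_iid.
pose F (z : R * (R * R)) := z.1 + z.2.1.
have mF : measurable_fun setT F.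
  by apply: measurable_funD => //; exact: measurableT_comp measurable_snd.
have stE k w : state F 0 Z k w = arrival W k w.
  elim: k => [|k IH] /=; first by rewrite /arrival big_ord0.
  by rewrite IH /F/= arrivalS.
have Mt0 : 0 <= Mt.
  by rewrite -lee_fin -MtE integral_ge0// => w _; rewrite lee_fin expR_ge0.
elim: n => [|n IH].
  rewrite expr0; under eq_integral do rewrite /arrival big_ord0 mulr0 expR0.
  by rewrite integral_cst// mul1e; exact: probability_setT.
pose g z := (expR (theta * F z))%:E : \bar R.
have -> : (\int[P]_w (expR (theta * arrival W n.+1 w))%:E =
           \int[P]_w g (state F (0 : R)%R Z n w, Z n w))%E.
  by apply: eq_integral => w _; rewrite /g -stE.
rewrite (expect_state_next (0 : R) mF ind same n)//; last 2 first.
- apply/measurable_EFinP; apply: measurableT_comp => //.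
  exact: measurable_funM.
- by move=> z; rewrite lee_fin expR_ge0.
have mTn := mexp theta (measurable_arrival n).
have mW : measurable_fun setT (fun w => (expR (theta * W0 w))%:E) by exact: mexp.
rewrite exprS EFinM -IH -(ge0_integralZl P measurableT mTn); last 2 first.
- by move=> w _; rewrite lee_fin expR_ge0.
- by rewrite lee_fin.
apply: eq_integral => w _.
rewrite -MtE muleC -(ge0_integralZl P measurableT mW); last 2 first.
- by move=> w' _; rewrite lee_fin expR_ge0.
- by rewrite lee_fin expR_ge0.
by apply: eq_integral => w' _; rewrite /g /F /= stE mulrDr expRD EFinM.
Qed.

Lemma arrival_tail theta Mt n t : 0 <= theta ->
  (\int[P]_w (expR (theta * W0 w))%:E = Mt%:E)%E ->
  (P [set w | (t <= arrival W n w)%R] <= (expR (- (theta * t)) * Mt ^+ n)%:E)%E.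
Proof.
move=> th0 MtE.
have mA : measurable [set w | t <= arrival W n w].
  by apply: measurable_set_le => //; exact: measurable_arrival.
rewrite (measure_integral_indic P mA).
have mTn := mexp theta (measurable_arrival n).
rewrite EFinM -(expect_arrival_exp n MtE) -(ge0_integralZl P measurableT mTn);
  last 2 first.
- by move=> w _; rewrite lee_fin expR_ge0.
- by rewrite lee_fin expR_ge0.
apply: le_integral_pointwise => w _; first by rewrite lee_fin.
rewrite indicE -EFinM lee_fin; case: (boolP (_ \in _)) => [|_]; last first.
  by rewrite mulr_ge0 ?expR_ge0.
rewrite inE /= => tw; rewrite -expRD -expR0 ler_expR.
by rewrite addrC subr_ge0 ler_wpM2l.
Qed.

Lemma mgf_interpolation l : 0 <= l <= 1 -> exists2 Mt : R,
  (\int[P]_w (expR (l * gamma * W0 w))%:E = Mt%:E)%E & 1 <= Mt <= 1 - l + l * M.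
Proof.
move=> /andP[l0 l1].
have h : (\int[P]_w (expR (l * gamma * W0 w))%:E <= (1 - l + l * M)%:E)%E.
  apply: (@le_trans _ _ (\int[P]_w ((1 - l)%:E + l%:E * (expR (gamma * W0 w))%:E))%E).
    apply: le_integral_pointwise => w _; first by rewrite lee_fin expR_ge0.
    by rewrite -EFinM -EFinD lee_fin -mulrA expR_secant// l0.
  rewrite ge0_integralD//; last 3 first.
  - by move=> w _; rewrite lee_fin subr_ge0.
  - by move=> w _; rewrite -EFinM lee_fin mulr_ge0// expR_ge0.
  - by apply: measurable_funeM; exact: mexp.
  have mW : measurable_fun setT (fun w => (expR (gamma * W0 w))%:E) by exact: mexp.
  rewrite (ge0_integralZl P measurableT mW); last 2 first.
  - by move=> w _; rewrite lee_fin expR_ge0.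
  - by rewrite lee_fin.
  rewrite ME integral_cst// [leRHS]EFinD [in leRHS]EFinM; apply: leeD2r.
  by rewrite -[leRHS]mule1 lee_wpmul2l ?lee_fin ?subr_ge0//; exact: probability_le1.
have lb : (1%:E <= \int[P]_w (expR (l * gamma * W0 w))%:E)%E.
  rewrite -[leLHS](@probability_setT _ _ _ P) -[leLHS]mul1e -integral_cst//.
  apply: le_integral_pointwise => w _ //=.
  by rewrite lee_fin -expR0 ler_expR mulr_ge0// mulr_ge0// ltW.
have fin : (\int[P]_w (expR (l * gamma * W0 w))%:E \is a fin_num)%E.
  rewrite ge0_fin_numE; first exact: le_lt_trans h (ltry _).
  by apply: integral_ge0 => w _; rewrite lee_fin expR_ge0.
exists (fine (\int[P]_w (expR (l * gamma * W0 w))%:E)%E); first by rewrite fineK.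
by rewrite -!lee_fin fineK// lb h.
Qed.
End estimates.

Lemma nneseries_geometric_le (R : realType) (a q : R) : 0 <= a -> 0 < q < 1 ->
  (\sum_(0 <= n <oo) (a * q ^+ n)%:E <= (a / (1 - q))%:E)%E.
Proof.
move=> a0 /andP[q0 q1]; apply: lime_le.
  by apply: is_cvg_nneseries => n _ _; rewrite lee_fin mulr_ge0// exprn_ge0// ltW.
apply: nearW => n; rewrite sumEFin lee_fin.
have := @geometric_le_lim R n a q a0 q0; rewrite (ger0_norm (ltW q0)) => /(_ q1).
by rewrite /series.
Qed.

Lemma le_geometric_mean (R : realType) (p a b r : R) :
  0 <= p -> 0 <= r -> p <= a -> p <= b -> a * b = r ^+ 2 -> p <= r.
Proof.
move=> p0 r0 pa pb abr; rewrite -(@ler_pXn2r _ 2)//.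
by rewrite -abr expr2 ler_pM.
Qed.

Section tail.
Context d (T : measurableType d) (R : realType) (P : probability T R).
Variables (c : R) (W0 X0 : {RV P >-> R}) (W X : nat -> {RV P >-> R}).
Hypothesis c_gt0 : 0 < c.
Hypothesis W0_ge0 : forall w, 0 <= W0 w.
Hypothesis X0_ge0 : forall w, 0 <= X0 w.
Hypothesis W_ge0 : forall i w, 0 <= W i w.
Let Z i : {RV P >-> (R * R)%type} := rvec (W i) (X i).
Hypothesis WX_iid : iid Z (rvec W0 X0).

Local Notation V v := (state (@gap_step R) v Z).

Let mV v n : measurable_fun setT (V v n).
Proof. by apply: measurable_state; exact: measurable_gap_step. Qed.

(** [0 <= V_n < W_n] places the hitting time in the payment period that ends with
    the arrival [n + 1]; a level hit, but not before time [t], makes that arrival late.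
    This event is easier to estimate because the two conditions can be bounded
    separately. *)
Definition late_crossing (v t : R) (n : nat) : set T :=
  [set w | 0 <= V v n w < W n w] `&` [set w | t <= arrival W n.+1 w].

Let m_crossing v n : measurable [set w | 0 <= V v n w < W n w].
Proof.
rewrite (_ : [set _ | _] = [set w | 0 <= V v n w] `&` [set w | V v n w < W n w]).
  by apply: measurableI; [exact: measurable_set_le|exact: measurable_set_lt].
by apply/seteqP; split=> z /= => [/andP[]//|[-> ->]].
Qed.

Lemma measurable_late_crossing v t n : measurable (late_crossing v t n).
Proof.
apply: measurableI => //.
by apply: measurable_set_le => //; exact: measurable_arrival.
Qed.

Lemma measurable_hit_before v t n : measurable (hit_before W X v t n).
Proof.
rewrite (_ : hit_before _ _ _ _ _ = [set w | 0 <= V v n w < W n w] `&`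
    [set w | arrival W n w + V v n w < t]).
  apply: measurableI => //; apply: measurable_set_lt => //.
  by apply: measurable_funD => //; exact: measurable_arrival.
by apply/seteqP; split=> z /= => [[h1 h2 h3]|[/andP[h1 h2] h3]]; split=> //; apply/andP.
Qed.

(** The two estimates of the crossing and of the late arrival vary with [n] like
    [sigma ^ n] and [Mt ^ n]; [theta = l * gamma] is taken so small that
    [sigma * Mt < 1], and the geometric mean keeps half of each exponential rate.
    *)
Lemma late_crossing_le gamma M K sigma C :
  0 < gamma -> (\int[P]_w (expR (gamma * W0 w))%:E = M%:E)%E -> 0 <= K ->
  0 < sigma < 1 -> 0 < C ->
  (forall n v, (iter n (gap_op W0 X0) (EFin \o lyap gamma K) v <=
     (C * sigma ^+ n)%:E * (EFin \o lyap gamma K) v)%E) ->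
  exists kappa q xi beta : R, [/\ 0 < kappa, 0 < q < 1, 0 < xi, 0 < beta &
    forall v t n, (P (late_crossing v t n) <=
      (kappa * expR (- (xi * t)) * expR (- (beta * v)) * q ^+ n)%:E)%E].
Proof.
move=> g0 ME K0 /andP[s0 s1] C0 geo.
have M1 := mgf_ge1 W0_ge0 g0 ME.
have M0 : 0 < M by apply: lt_le_trans M1.
pose l := (1 - sigma) / (2 * M).
have l0 : 0 < l by rewrite divr_gt0 ?mulr_gt0// subr_gt0.
have lM : l * M = (1 - sigma) / 2 by rewrite /l; field; rewrite gt_eqF.
have l1 : l <= 1.
  rewrite ler_pdivrMr ?mulr_gt0// mul1r; lra.
have [|Mt MtE /andP[Mt1 MtM]] := mgf_interpolation W0_ge0 g0 ME (l := l).
  by rewrite ltW.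
pose theta := l * gamma.
have th0 : 0 < theta by rewrite mulr_gt0.
have Mt0 : 0 < Mt by apply: lt_le_trans Mt1.
(* [Mt <= 1 + l * M] and [l * M = (1 - sigma) / 2], hence
   [sigma * Mt <= sigma + sigma * (1 - sigma) / 2]. *)
have sMt : 0 < sigma * Mt < 1 by rewrite mulr_gt0//=; nra.
have /andP[sMt0 sMt1] := sMt.
pose B := M * C * expR (gamma * K) * Mt.
have B0 : 0 < B by rewrite !mulr_gt0 ?expR_gt0.
exists (Num.sqrt B), (Num.sqrt (sigma * Mt)), (theta / 2), (gamma / 2); split.
- by rewrite sqrtr_gt0.
- by rewrite sqrtr_gt0 sMt0 -[ltRHS]sqrtr1 ltr_sqrt.
- by rewrite divr_gt0.
- by rewrite divr_gt0.
move=> v t n.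
have mL := measurable_late_crossing v t n.
have pfin : P (late_crossing v t n) \is a fin_num by rewrite fin_num_measure.
rewrite -(fineK pfin) lee_fin.
apply: (@le_geometric_mean _ _
  (M * C * expR (gamma * K) * expR (- (gamma * v)) * sigma ^+ n)
  (expR (- (theta * t)) * Mt ^+ n.+1)).
- by rewrite fine_ge0.
- by rewrite !mulr_ge0 ?expR_ge0 ?exprn_ge0 ?sqrtr_ge0.
- rewrite -lee_fin fineK//.
  apply: (@le_trans _ _ (P [set w | (0 <= V v n w < W n w)%R])).
    by apply: le_measure; rewrite ?inE//; exact: subIsetl.
  apply: le_trans (crossing_le W0_ge0 WX_iid g0 ME v n K0) _.
  rewrite -!mulrA EFinM; apply: lee_wpmul2l; first by rewrite lee_fin ltW.
  apply: le_trans (geo n v) _; rewrite -EFinM lee_fin -mulrA ler_wpM2l ?(ltW C0)//.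
  rewrite mulrCA [leRHS]mulrA mulrC; apply: ler_wpM2r; first by rewrite exprn_ge0// ltW.
  by apply: le_trans (lyap_le_exp _ _ _) _; rewrite -expRD ler_expR; lra.
- rewrite -lee_fin fineK//.
  apply: le_trans (arrival_tail WX_iid n.+1 t (ltW th0) MtE).
  apply: le_measure; rewrite ?inE//; last exact: subIsetr.
  by apply: measurable_set_le => //; exact: measurable_arrival.
- rewrite !exprMn -exprM mulnC exprM !sqr_sqrtr ?(ltW sMt0) ?(ltW B0)//.
  rewrite !expr2 -!expRD exprMn exprS /B.
  have -> : - (theta / 2 * t) + - (theta / 2 * t) = - (theta * t) by field.
  have -> : - (gamma / 2 * v) + - (gamma / 2 * v) = - (gamma * v) by field.
  ring.
Qed.

(** * Convergence of the hitting probabilities *)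

Lemma hitting_event_measurable u t : 0 < u ->
  measurable [set w | (hitting_time c W X u w < t%:E)%E].
Proof.
move=> u0; rewrite hitting_time_ltE//.
by apply: bigcup_measurable => n _; exact: measurable_hit_before.
Qed.

Lemma hitting_event_subset u s t : 0 < u ->
  [set w | (hitting_time c W X u w < s%:E)%E] `<=`
  [set w | (hitting_time c W X u w < t%:E)%E] `|` \bigcup_n late_crossing (u / c) t n.
Proof.
move=> u0; rewrite !hitting_time_ltE// => w [n _ [V0 VW TV]].
have [Vt|Vt] := ltP (arrival W n w + V (u / c) n w) t; first by left; exists n.
right; exists n => //; split; first by apply/andP.
by rewrite /= arrivalS; apply: le_trans Vt _; rewrite lerD2l ltW.
Qed.

Section psi_bounds.
Variables (kappa q xi beta : R).
Hypotheses (kappa0 : 0 < kappa) (q01 : 0 < q < 1).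
Hypothesis late_le : forall v t n, (P (late_crossing v t n) <=
  (kappa * expR (- (xi * t)) * expR (- (beta * v)) * q ^+ n)%:E)%E.

Lemma psi_homo u : 0 < u -> {homo psi c W X u : s t / s <= t}.
Proof.
move=> u0 s t st; apply: fine_le; rewrite ?fin_num_measure//;
  try exact: hitting_event_measurable.
apply: le_measure; rewrite ?inE; try exact: hitting_event_measurable.
by move=> w /= h; apply: lt_le_trans h _; rewrite lee_fin.
Qed.

Lemma psi_increment u s t : 0 < u ->
  psi c W X u s <= psi c W X u t +
    kappa / (1 - q) * expR (- (xi * t)) * expR (- (beta * (u / c))).
Proof.
move=> u0; rewrite /psi.
have mh r := hitting_event_measurable r u0.
have fin r : P [set w | (hitting_time c W X u w < r%:E)%E] \is a fin_num.
  by rewrite fin_num_measure.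
rewrite -lee_fin EFinD !fineK//.
have mU : measurable (\bigcup_n late_crossing (u / c) t n).
  by apply: bigcup_measurable => n _; exact: measurable_late_crossing.
apply: (@le_trans _ _ (P ([set w | (hitting_time c W X u w < t%:E)%E] `|`
    \bigcup_n late_crossing (u / c) t n))).
  apply: le_measure; rewrite ?inE//; first exact: measurableU.
  exact: hitting_event_subset.
apply: le_trans (measureU2 _ _ _) _ => //; apply: leeD2l.
have mL n := measurable_late_crossing (u / c) t n.
apply: le_trans (measure_sigma_subadditive P mL mU (@subset_refl _ _)) _.
apply: (@le_trans _ _ (\sum_(0 <= n <oo)
    (kappa * expR (- (xi * t)) * expR (- (beta * (u / c))) * q ^+ n)%:E)%E).
  by apply: lee_nneseries => // n _; exact: late_le.
apply: le_trans (nneseries_geometric_le _ q01) _.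
  by rewrite !mulr_ge0 ?expR_ge0 ?(ltW kappa0).
rewrite lee_fin le_eqVlt; apply/orP; left; apply/eqP; ring.
Qed.

Lemma psi_infty_bounds u t : 0 < u ->
  0 <= psi_infty c W X u - psi c W X u t <=
    kappa / (1 - q) * expR (- (xi * t)) * expR (- (beta * (u / c))).
Proof.
move=> u0.
have ub : has_ubound (range (psi c W X u)).
  exists (psi c W X u 0 + kappa / (1 - q) * expR (- (xi * 0)) *
     expR (- (beta * (u / c)))) => _ [s _ <-].
  exact: psi_increment.
have -> : psi_infty c W X u = sup (range (psi c W X u)).
  by apply: cvg_lim => //; exact: nondecreasing_cvgr (psi_homo u0) ub.
apply/andP; split.
  by rewrite subr_ge0; apply: ub_le_sup => //; exists t.
rewrite lerBlDl; apply: ge_sup; first by exists (psi c W X u 0), 0.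
by move=> _ [s _ <-]; exact: psi_increment.
Qed.
End psi_bounds.

(** The density is used for the two null events [X0 = 0] and, for [v > 0],
    [(v - W0) * exp X0 = v]: both are supported by curves met at most once by every
    line [W0 = x]. *)
Lemma gap_kernel_decay (f : R * R -> R) gamma :
  (0 < P [set w | (0 < X0 w)%R])%E -> (0 < P [set w | (0 < W0 w)%R])%E ->
  joint_density W0 X0 f -> 0 < gamma ->
  (\int[P]_w (expR (gamma * W0 w))%:E < +oo)%E ->
  exists K sigma C : R, [/\ 0 <= K, 0 < sigma < 1, 0 < C &
    forall n v, (iter n (gap_op W0 X0) (EFin \o lyap gamma K) v <=
      (C * sigma ^+ n)%:E * (EFin \o lyap gamma K) v)%E].
Proof.
move=> Xpos Wpos dens g0 Mfin.
have mstep v : measurable_fun setT (fun z : R * R => gap_step (v, z)).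
  by apply: measurableT_comp; [exact: measurable_gap_step|exact: measurable_fun_pair].
have Xnull : P [set w | X0 w = 0] = 0%E.
  apply: (joint_density_null (A := [set z | z.2 = 0]) dens).
    exact: measurable_set_eq.
  by move=> x y1 y2 /= -> ->.
have nofix v : 0 < v -> P [set w | (v - W0 w) * expR (X0 w) = v] = 0%E.
  move=> v0; apply: (joint_density_null (A := [set z | gap_step (v, z) = v]) dens).
    exact: measurable_set_eq.
  move=> x y1 y2; rewrite /gap_step/= => h1 h2.
  apply: expR_inj; apply: (@mulfI _ (v - x)); last by rewrite h1 h2.
  by apply/eqP => e; move: h1; rewrite e mul0r => h; rewrite -h ltxx in v0.
have [K K0 drift] := lyap_drift X0_ge0 g0 Mfin Xnull.
have [v0 [delta [eta [d0 e01 up down]]]] :=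
  gap_step_spread W0_ge0 X0_ge0 Wpos Xpos nofix.
have [sigma [C [s01 C0 geo]]] :=
  lyap_geometric W0_ge0 X0_ge0 g0 drift d0 e01 up down.
by exists K, sigma, C.
Qed.
End tail.

Theorem theorem3p1 (R : realType) (d : measure_display) (T : measurableType d)
    (P : probability T R) (c : R)
    (W0 X0 : {RV P >-> R}) (f : R * R -> R) (W X : nat -> {RV P >-> R})
    (c_gt0 : 0 < c)
    (W0_ge0 : forall w, 0 <= W0 w) (X0_ge0 : forall w, 0 <= X0 w)
    (W_ge0 : forall i w, 0 <= W i w) (X_ge0 : forall i w, 0 <= X i w)
    (WX_iid : iid (fun i => rvec (W i) (X i) : {RV P >-> (R * R)%type})
                  (rvec W0 X0))
    (X0_pos : (0 < P [set w | (0 < X0 w)%R])%E)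
    (W0_mean : ('E_P[W0] < +oo)%E)
    (W0_pos : (0 < P [set w | (0 < W0 w)%R])%E)
    (WX_density : joint_density W0 X0 f)
    (W0_mgf : exists2 theta0 : R, 0 < theta0 &
       forall theta : R, theta < theta0 -> ('M_P W0 theta < +oo)%E) :
  (exists xi C : R, [/\ 0 < xi, 0 < C &
     forall t : R, 0 < t ->
       (\int[@lebesgue_measure R]_(u in `]0%R, +oo[)
          (`|psi_infty c W X u - psi c W X u t|)%:E
        <= (C * expR (- xi * t))%:E)%E]) /\
  (exists2 xi' : R, 0 < xi' &
     forall u : R, 0 < u ->
       exists2 C : R, 0 < C &
         forall t : R, 0 < t ->
           0 <= psi_infty c W X u - psi c W X u t <= C * expR (- xi' * t)).
Proof.
have [theta0 th0 mgf] := W0_mgf.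
pose gamma := theta0 / 2.
have g0 : 0 < gamma by rewrite divr_gt0.
have Mfin : (\int[P]_w (expR (gamma * W0 w))%:E < +oo)%E.
  have := mgf gamma; rewrite /mmt_gen_fun unlock /=.
  under eq_integral do rewrite mulrC.
  by apply; rewrite /gamma; lra.
pose M := fine (\int[P]_w (expR (gamma * W0 w))%:E)%E.
have ME : (\int[P]_w (expR (gamma * W0 w))%:E = M%:E)%E.
  rewrite fineK// ge0_fin_numE//.
  by apply: integral_ge0 => w _; rewrite lee_fin expR_ge0.
have [K [sigma [C [K0 s01 C0 geo]]]] :=
  gap_kernel_decay W0_ge0 X0_ge0 X0_pos W0_pos WX_density g0 Mfin.
have [kappa [q [xi [beta [k0 q01 xi0 b0 late]]]]] :=
  late_crossing_le W0_ge0 WX_iid g0 ME K0 s01 C0 geo.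
have bounds := psi_infty_bounds c_gt0 W_ge0 k0 q01 late.
pose A := kappa / (1 - q).
have A0 : 0 < A by have /andP[_ q1] := q01; rewrite divr_gt0// subr_gt0.
split.
  have bc0 : 0 < beta / c by rewrite divr_gt0.
  exists xi, (A / (beta / c)); split=> [//||t t0]; first by apply: divr_gt0 A0 bc0.
  apply: (@le_trans _ _ (\int[@lebesgue_measure R]_(u in `]0%R, +oo[)
    (A * expR (- xi * t) * expR (- (beta / c) * u))%:E)%E).
    apply: le_integral_pointwise => u; first by rewrite lee_fin.
    rewrite /= in_itv/= andbT => u0; have /andP[h0 h1] := bounds u t u0.
    rewrite lee_fin ger0_norm// !mulNr.
    by rewrite (_ : beta / c * u = beta * (u / c)); last ring.
  apply: le_trans (integral_exp_le bc0 _) _; first by rewrite mulr_ge0 ?expR_ge0 ?ltW.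
  by rewrite lee_fin mulrAC.
exists xi => // u u0; exists (A * expR (- (beta * (u / c)))).
  by rewrite mulr_gt0 ?expR_gt0.
move=> t t0; have /andP[-> h1] := bounds u t u0.
by rewrite mulNr mulrAC.
Qed.
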